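(* Let $N\ge1$ and $\gamma\in(0,N)$. There exists a nonnegative $\mathbf{w}\in L^1_{\mathrm{loc}}(\mathbb{R}^N)$ such that, with $F(R):=\int_{|x|\le R}\mathbf{w}(x)\,dx$, $$\limsup_{R\to\infty}\frac{F(R)}{R^\gamma}>0\qquad\text{while}\qquad \liminf_{R\to\infty}\frac{F(R)}{R^\gamma}=0.$$ In particular $F\notin\mathrm{RV}_\gamma$, and neither of the following two hypotheses is satisfied: (a) $\liminf_{R\to\infty}R^{-\gamma}F(R)>0$; (b) $F$ is eventually positive and $F\in\mathrm{RV}_\gamma$.
   Context: A measurable function $V:[A,\infty)\to(0,\infty)$, $A>0$, belongs to $\mathrm{RV}_\rho$ ($\rho\in\mathbb{R}$), the class of regularly varying functions of index $\rho$, if $\lim_{t\to\infty}V(tx)/V(t)=x^\rho$ for every $x>0$. *)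

(* Defs.v *)
From HB Require Import structures.
From mathcomp Require Import all_boot all_order all_algebra.
From mathcomp Require Import all_classical all_reals all_analysis.

Set Implicit Arguments.
Unset Strict Implicit.
Unset Printing Implicit Defensive.

Import Order.TTheory GRing.Theory Num.Theory.
Import numFieldNormedType.Exports.

Local Open Scope classical_set_scope.
Local Open Scope ring_scope.

(* R^n is 'rV[R]_n, whose topology is the library's. Its measurable sets are the
   product sigma-algebra generated by the coordinates, which is the Borel
   sigma-algebra of R^n. *)
Definition rV_display : measure_display.
Proof. exact: default_measure_display. Qed.

Section measurable_rV.
Context (R : realType) (n : nat).

Let coord (i : 'I_n) (v : 'rV[R]_n) : measurableTypeR R := v ord0 i.

Let rV_set0 : g_sigma_preimage coord set0.
Proof. exact: sigma_algebra0. Qed.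

Let rV_setC A : g_sigma_preimage coord A -> g_sigma_preimage coord (~` A).
Proof. exact: sigma_algebraC. Qed.

Let rV_bigcup (A : (set 'rV[R]_n)^nat) :
  (forall i, g_sigma_preimage coord (A i)) ->
  g_sigma_preimage coord (\bigcup_i A i).
Proof. exact: sigma_algebra_bigcup. Qed.

HB.instance Definition _ := @isMeasurable.Build rV_display
  'rV[R]_n (g_sigma_preimage coord) rV_set0 rV_setC rV_bigcup.

Lemma measurable_rV_coord (i : 'I_n) :
  measurable_fun [set: 'rV[R]_n] (fun v : 'rV[R]_n => v ord0 i).
Proof.
move=> _ Y mY; rewrite setTI; apply: sub_sigma_algebra => /=.
rewrite -bigcup_seq/=; exists i => /=; first by rewrite mem_index_enum.
by exists Y => //; rewrite setTI.
Qed.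

Lemma measurable_rV_box (A : 'I_n -> set (measurableTypeR R)) :
  (forall i, measurable (A i)) ->
  measurable [set v : 'rV[R]_n | forall i, A i (v ord0 i)].
Proof.
move=> mA; rewrite [X in measurable X](_ : _ =
    \big[setI/setT]_(i < n) ((fun v : 'rV[R]_n => v ord0 i) @^-1` A i)).
  apply: bigsetI_measurable => i _; rewrite -[X in measurable X]setTI.
  exact: measurable_rV_coord (mA i).
rewrite -bigcap_seq; apply/seteqP; split => v /= h i; first by move=> _; exact: h.
by apply: (h i); rewrite /= mem_index_enum.
Qed.

Lemma measurable_fun_rVP d (T : measurableType d) (f : T -> 'rV[R]_n) :
  (forall i, measurable_fun setT (fun t => f t ord0 i)) ->
  measurable_fun setT f.
Proof.
move=> mf _ A mA; rewrite setTI.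
suff : g_sigma_preimage coord `<=` [set B | measurable (f @^-1` B)] by exact.
apply: smallest_sub.
  split => /=.
  - by rewrite preimage_set0.
  - by move=> B mB; rewrite setTD preimage_setC; exact: measurableC.
  - by move=> B mB; rewrite preimage_bigcup; exact: bigcupT_measurable.
move=> B; rewrite -bigcup_seq => -[i _ [C mC <-]]/=.
rewrite setTI -[X in measurable X]setTI; exact: (mf i measurableT C mC).
Qed.

End measurable_rV.

Section consrV.
Context (R : realType) (n : nat).

Definition consrV (p : measurableTypeR R * 'rV[R]_n) : 'rV[R]_n.+1 :=
  row_mx (p.1 : R)%:M p.2.

Definition unconsrV (v : 'rV[R]_n.+1) : measurableTypeR R * 'rV[R]_n :=
  (v ord0 ord0, \row_i v ord0 (lift ord0 i)).

Lemma consrV0 p : consrV p ord0 ord0 = p.1.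
Proof.
transitivity (((p.1 : R)%:M : 'M[R]_1) ord0 ord0); last by rewrite mxE mulr1n.
rewrite -(row_mxEl ((p.1 : R)%:M : 'M[R]_1) p.2 ord0 ord0).
by congr (fun_of_matrix _ _ _); exact/val_inj.
Qed.

Lemma consrVS p i : consrV p ord0 (lift ord0 i) = p.2 ord0 i.
Proof.
rewrite -(row_mxEr ((p.1 : R)%:M : 'M[R]_1) p.2 ord0 i).
by congr (fun_of_matrix _ _ _); exact/val_inj.
Qed.

Lemma consrVK : cancel consrV unconsrV.
Proof.
move=> [x v]; congr pair; first by rewrite consrV0.
by apply/rowP => i; rewrite mxE consrVS.
Qed.

Lemma measurable_consrV : measurable_fun setT consrV.
Proof.
apply: measurable_fun_rVP => i; case: (unliftP ord0 i) => [j|] ->.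
- under eq_fun do rewrite consrVS.
  exact: (measurableT_comp (@measurable_rV_coord R n j) measurable_snd).
- under eq_fun do rewrite consrV0; exact: measurable_fst.
Qed.

Lemma measurable_unconsrV : measurable_fun setT unconsrV.
Proof.
apply/measurable_fun_pairP; split; first exact: measurable_rV_coord.
apply: measurable_fun_rVP => i /=.
under eq_fun do rewrite mxE.
exact: measurable_rV_coord.
Qed.

End consrV.

Section lebesgue_rVS.
Context (R : realType) (n : nat).
Variable mu : {sigma_finite_measure set 'rV[R]_n -> \bar R}.

Definition lebesgue_rVS : set 'rV[R]_n.+1 -> \bar R :=
  pushforward (lebesgue_measure \x mu)%E (@consrV R n).

Let lebesgue_rVS0 : lebesgue_rVS set0 = 0%E.
Proof. by rewrite /lebesgue_rVS /pushforward preimage_set0 measure0. Qed.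

Let lebesgue_rVS_ge0 A : (0 <= lebesgue_rVS A)%E.
Proof. by rewrite /lebesgue_rVS /pushforward measure_ge0. Qed.

Let lebesgue_rVS_sigma_additive : semi_sigma_additive lebesgue_rVS.
Proof.
move=> F mF tF mUF; rewrite /lebesgue_rVS /pushforward preimage_bigcup.
have mpre A : measurable A -> measurable (@consrV R n @^-1` A).
  by move=> mA; rewrite -[X in measurable X]setTI; exact: measurable_consrV.
apply: measure_semi_sigma_additive => [k||].
- exact: mpre.
- apply/trivIsetP => i j _ _ ij; rewrite -preimage_setI.
  by move/trivIsetP : tF => /(_ _ _ _ _ ij) ->//; rewrite preimage_set0.
- by rewrite -preimage_bigcup; exact: mpre.
Qed.

HB.instance Definition _ := isMeasure.Build _ _ _ lebesgue_rVS
  lebesgue_rVS0 lebesgue_rVS_ge0 lebesgue_rVS_sigma_additive.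

Lemma lebesgue_rVS_sigma_finite : sigma_finite setT lebesgue_rVS.
Proof.
have /sigma_finiteP[F [FT ndF mF]] := sigma_finiteT (@lebesgue_measure R).
have /sigma_finiteP[G [GT ndG mG]] := sigma_finiteT mu.
exists (fun k => @unconsrV R n @^-1` (F k `*` G k)).
  apply/esym/seteqP; split => // v _.
  have [i _ Fi] : (\bigcup_i F i) (unconsrV v).1 by rewrite -FT.
  have [j _ Gj] : (\bigcup_i G i) (unconsrV v).2 by rewrite -GT.
  exists (maxn i j) => //; split.
  - by move: Fi; exact/subsetPset/ndF/leq_maxl.
  - by move: Gj; exact/subsetPset/ndG/leq_maxr.
move=> k; have [mFk Fk] := mF k; have [mGk Gk] := mG k; split.
  rewrite -[X in measurable X]setTI; apply: measurable_unconsrV => //.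
  exact: measurableX.
rewrite /lebesgue_rVS /pushforward -comp_preimage.
rewrite (_ : _ \o _ = idfun); last by apply/funext => p /=; rewrite consrVK.
by rewrite preimage_id product_measure1E// lte_mul_pinfty// ge0_fin_numE.
Qed.

HB.instance Definition _ :=
  Measure_isSigmaFinite.Build _ _ _ lebesgue_rVS lebesgue_rVS_sigma_finite.

End lebesgue_rVS.

(* n-dimensional Lebesgue measure as the n-fold product of the one-dimensional
   one, transported along R * R^n ~ R^(n+1); see lebesgue_rV_box. *)
Fixpoint lebesgue_rV (R : realType) (n : nat) :
    {sigma_finite_measure set 'rV[R]_n -> \bar R} :=
  match n with
  | 0 => \d_(0 : 'rV[R]_0)
  | m.+1 => lebesgue_rVS (lebesgue_rV R m)
  end.

Lemma lebesgue_rV_box (R : realType) (n : nat)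
    (A : 'I_n -> set (measurableTypeR R)) :
  (forall i, measurable (A i)) ->
  lebesgue_rV R n [set v | forall i, A i (v ord0 i)] =
  (\prod_(i < n) lebesgue_measure (A i))%E.
Proof.
elim: n A => [|n IH] A mA.
  rewrite big_ord0 /= diracE (_ : _ \in _ = true)//.
  by apply/mem_set => -[].
rewrite big_ord_recl -IH; last by move=> i; exact: mA.
rewrite -product_measure1E; last 2 first.
- exact: (mA ord0).
- exact: (measurable_rV_box (fun i => mA (lift ord0 i))).
congr ((_ \x _)%E _).
apply/seteqP; split => -[x v] /=.
  move=> h; split => [|i]; first by have := h ord0; rewrite consrV0.
  by have := h (lift ord0 i); rewrite consrVS.
move=> [Ax Av] i; case: (unliftP ord0 i) => [j|] ->; rewrite ?consrV0//.
by rewrite consrVS; exact: Av.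
Qed.

(* Euclidean norm: the library's norm on 'rV[R]_n is the maximum norm. *)
Definition enorm (R : realType) (n : nat) (x : 'rV[R]_n) : R :=
  Num.sqrt (\sum_i x ord0 i ^+ 2).

(* L^1_loc(R^n), following the library's one-dimensional locally_integrable. *)
Definition locally_integrable_rV (R : realType) (n : nat) (w : 'rV[R]_n -> R) :=
  measurable_fun setT w /\
  forall K : set 'rV[R]_n, compact K ->
    (\int[lebesgue_rV R n]_(x in K) `|w x|%:E < +oo)%E.

Definition ball_mass (R : realType) (n : nat) (w : 'rV[R]_n -> R) (r : R) : R :=
  \int[lebesgue_rV R n]_(x in [set x | enorm x <= r]) w x.

(* A function V on the whole line is regarded as regularly varying when its
   restriction to some half-line [A, +oo), A > 0, is. *)
Definition regularly_varying (R : realType) (rho : R) (V : R -> R) :=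
  exists2 A : R, 0 < A &
    [/\ measurable_fun `[A, +oo[ V,
        forall t, A <= t -> 0 < V t &
        forall x, 0 < x -> V (t * x) / V t @[t --> +oo] --> x `^ rho].

(* Main.v *)
Require Import Defs.
From mathcomp Require Import all_boot all_order all_algebra.
From mathcomp Require Import all_classical all_reals all_analysis.
From mathcomp Require Import measurable_realfun lra.
Import Order.TTheory GRing.Theory Num.Theory.
Import numFieldNormedType.Exports.
Local Open Scope classical_set_scope.
Local Open Scope ring_scope.

(** The mass [F] of the balls is made to grow by rare jumps. Along a very fast
    sequence of radii [a k] (here [spike R k]), put in the region where the first
    coordinate lies in [`]a k, a k + 1]] a brick of volume one, and let the
    weight be the [gamma]-th power of the first coordinate there and zero
    elsewhere (definition [weight]).

    - The brick at [a k] lies inside the ball of radius [l * a k] for a constant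
      [l] depending on the dimension only, so [a k `^ gamma <= F (l * a k)]
      ([ball_mass_spike_ge]): the upper limit is at least [l `^ (- gamma)].

    - The ball of radius [a k.+1] meets only the bricks up to the [k]-th, so
      [F (a k.+1) <= (a k + 1) `^ (gamma + 1)] ([ball_mass_spike_le]). As
      [a k.+1 = (a k + 1) ^+ k.+1], this is negligible with respect to
      [a k.+1 `^ gamma] ([spike_decay]), and the lower limit vanishes.

    - Together, the bounds make [F (l * t) / F t] unbounded along [t = a k],
      although it would tend to [l `^ gamma] if [F] were regularly varying of
      index [gamma] ([not_regularly_varying_seq]). *)

(** * Limits along a sequence *)

Lemma le_limf_esup_seq (R : realType) (f : R -> \bar R) (u : R^nat)
    (c : \bar R) :
  u @ \oo --> +oo -> (forall k, (c <= f (u k))%E) ->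
  (c <= limf_esup f +oo%R)%E.
Proof.
move=> uoo cf; rewrite limf_esupE; apply: le_ereal_inf_tmp => _ [V Voo <-].
have [k _ Vk] := uoo _ Voo.
apply: (le_trans (cf k)); apply: ereal_sup_ubound.
by exists (u k) => //; apply: Vk => /=.
Qed.

Lemma limf_einf_seq_le (R : realType) (f : R -> \bar R) (u : R^nat)
    (c : \bar R) :
  u @ \oo --> +oo -> (forall k, (f (u k) <= c)%E) ->
  (limf_einf f +oo%R <= c)%E.
Proof.
move=> uoo fc; rewrite /limf_einf leeNl.
apply: (le_limf_esup_seq _ _ _ _ uoo) => k.
by rewrite leeN2.
Qed.

Lemma limf_einf_ge0 (R : realType) (f : R -> \bar R) :
  (forall r, (0 <= f r)%E) -> (0 <= limf_einf f +oo%R)%E.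
Proof.
move=> f0; rewrite /limf_einf leeNr oppe0 limf_esupE.
apply: (@le_trans _ _ (ereal_sup ((\- f)%E @` setT))).
  by apply: ereal_inf_lbound; exists setT => //; exact: filterT.
by apply: ge_ereal_sup => _ [r _ <-]; rewrite leeNl oppe0.
Qed.

Lemma limf_einf_seq0 (R : realType) (f : R -> R) (u : R^nat) :
  (forall r, 0 <= f r) -> u @ \oo --> +oo -> f (u k) @[k --> \oo] --> 0 ->
  limf_einf (fun r => (f r)%:E) +oo%R = 0%E.
Proof.
move=> f0 uoo fu0; apply/eqP; rewrite eq_le limf_einf_ge0 ?andbT; last first.
  by move=> r; rewrite lee_fin.
apply/lee_addgt0Pr => e e0; rewrite add0e.
have [n _ un] : \forall k \near \oo, f (u k) < e.
  by apply: (cvgr_lt _ fu0 _ e0).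
(* The bound holds only from rank [n] on, so [u] is shifted by [n]. *)
apply: (@limf_einf_seq_le _ _ (fun k => u (k + n)%N)).
  by have := uoo; rewrite -(cvg_shiftn n).
by move=> k; rewrite lee_fin ltW// un//= leq_addl.
Qed.

(** If [V] were regularly varying, [V (l * u k) / V (u k)] would converge, hence
    so would its product with the null sequence [V (u k) / u k `^ rho], and to
    [0]; but that product is [V (l * u k) / u k `^ rho], which stays above
    [c]. A lower limit zero and a positive upper limit would not suffice here:
    a regularly varying function may oscillate in this way, but only slowly,
    whereas [V] recovers within the fixed factor [l]. *)
Lemma not_regularly_varying_seq (R : realType) (rho l c : R) (V : R -> R)
    (u : R^nat) :
  0 < l -> 0 < c -> u @ \oo --> +oo ->
  V (u k) / u k `^ rho @[k --> \oo] --> 0 ->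
  (forall k, c <= V (l * u k) / u k `^ rho) ->
  ~ regularly_varying rho V.
Proof.
move=> l0 c0 uoo Vu0 cV [A A0 [_ Vpos /(_ _ l0) Vl]].
have Vlu : V (u k * l) / V (u k) @[k --> \oo] --> l `^ rho.
  exact: (cvg_comp _ _ uoo Vl).
have P0 : V (u k * l) / V (u k) * (V (u k) / u k `^ rho) @[k --> \oo] --> 0.
  by rewrite -(mulr0 (l `^ rho)); exact: cvgM.
have [n _ Pn] := cvgr_lt _ P0 _ c0.
have [m _ um] := (cvgryPge u).1 uoo A.
have := Pn _ (leq_maxl n m); have Vk := Vpos _ (um _ (leq_maxr n m)).
have := cV (maxn n m).
rewrite [l * _]mulrC mulrA divfK ?gt_eqF// => ?.
by rewrite ltNge => /negP; apply.
Qed.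

(** * Integrals over bricks *)

(** Monotonicity in both the integrand and the domain, without any measurability:
    the integral of a nonnegative function is a supremum over the simple
    functions below it. Hence neither balls nor compact sets of ['rV[R]_n] have
    to be shown measurable. *)
Lemma le_integral_restrict d (T : measurableType d) (R : realType)
    (mu : {measure set T -> \bar R}) (D E : set T) (f g : T -> \bar R) :
  (forall x, D x -> (0 <= f x)%E) -> (forall x, E x -> (0 <= g x)%E) ->
  (forall x, ((f \_ D) x <= (g \_ E) x)%E) ->
  (\int[mu]_(x in D) f x <= \int[mu]_(x in E) g x)%E.
Proof.
move=> f0 g0 fg; rewrite !ge0_integralE//; apply: ereal_sup_le => _ [h hf <-].
by exists h => //= x; exact: le_trans (hf x) (fg x).
Qed.

(** The first side is open on the left so that the brick starting at
    [spike R k] does not meet the closed ball of radius [spike R k]. *)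
Definition brick_side (R : realType) (n : nat) (a b : R) (i : 'I_n.+1) :
    set (measurableTypeR R) :=
  if i == ord0 then `]a, b]%classic else `[0, 1]%classic.

Definition brick (R : realType) (n : nat) (a b : R) : set 'rV[R]_n.+1 :=
  [set v | forall i, brick_side R n a b i (v ord0 i)].

Lemma brick_side_measurable (R : realType) (n : nat) (a b : R) i :
  measurable (brick_side R n a b i).
Proof. by rewrite /brick_side; case: ifP => _; exact: measurable_itv. Qed.

Lemma brick_measurable (R : realType) (n : nat) (a b : R) :
  measurable (brick R n a b).
Proof. exact: (measurable_rV_box (@brick_side_measurable R n a b)). Qed.

Lemma brick_coord0 (R : realType) (n : nat) (a b : R) x :
  brick R n a b x -> a < x ord0 ord0 <= b.
Proof. by move=> /(_ ord0); rewrite /brick_side eqxx /= in_itv. Qed.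

Lemma lebesgue_brick (R : realType) (n : nat) (a b : R) : a <= b ->
  lebesgue_rV R n.+1 (brick R n a b) = (b - a)%:E.
Proof.
move=> ab; rewrite (lebesgue_rV_box (@brick_side_measurable R n a b)).
rewrite big_ord_recl {1}/brick_side eqxx big1 ?mule1; last first.
  by move=> i _; rewrite lebesgue_measure_itv/= lte_fin ltr01 oppr0 adde0.
rewrite lebesgue_measure_itv/= lte_fin; case: ltgtP ab => // ->.
by rewrite subrr.
Qed.

Lemma integral_brick (R : realType) (n : nat) (a b c : R) : a <= b ->
  (\int[lebesgue_rV R n.+1]_(x in brick R n a b) c%:E)%E = (c * (b - a))%:E.
Proof.
move=> ab; rewrite EFinM -(lebesgue_brick R n a b ab).
exact: (integral_cst (lebesgue_rV R n.+1) (brick_measurable R n a b)).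
Qed.

(** * A rapidly growing sequence *)

(** The growing exponent makes [spike R k.+1 `^ gamma] dominate
    [(spike R k + 1) `^ (gamma + 1)] for every [gamma > 0]; a constant exponent
    [p] would only do so when [gamma + 1 < p * gamma]. *)
Fixpoint spike (R : realType) (k : nat) : R :=
  if k is j.+1 then (spike R j + 1) ^+ k else 1.

Lemma spike_ge (R : realType) k : k.+1%:R <= spike R k.
Proof.
elim: k => [//|k IH]; rewrite -natr1 /=.
have s1 : 1 <= spike R k + 1 by rewrite lerDr (le_trans _ IH).
apply: le_trans (_ : spike R k + 1 <= _); first by rewrite lerD2r.
by rewrite exprS ler_peMr ?exprn_ege1// (le_trans _ s1).
Qed.

Lemma spike_ge1 (R : realType) k : 1 <= spike R k.
Proof. by apply: le_trans (spike_ge R k); rewrite ler1n. Qed.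

Lemma spike_gt0 (R : realType) k : 0 < spike R k.
Proof. exact: lt_le_trans (spike_ge1 R k). Qed.

Lemma spikeS_le (R : realType) k : spike R k + 1 <= spike R k.+1.
Proof.
have s1 : 1 <= spike R k + 1 by rewrite lerDr ltW// spike_gt0.
by rewrite /= exprS ler_peMr ?exprn_ege1// (le_trans _ s1).
Qed.

Lemma spike_le (R : realType) : {homo spike R : i j / (i <= j)%N >-> i <= j}.
Proof.
apply: homo_leq => [x|y x z|k]; first exact: lexx.
  exact: le_trans.
by apply: le_trans (spikeS_le R k); rewrite lerDl.
Qed.

Lemma spike_cvg (R : realType) : spike R @ \oo --> +oo.
Proof.
apply/cvgryPge => A; near=> k; apply: le_trans (spike_ge R k).
rewrite -natr1; apply: (@le_trans _ _ k%:R); last by rewrite lerDl.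
near: k; exact: nbhs_infty_ger.
Unshelve. all: by end_near. Qed.

(** Once [2 <= k * gamma], the denominator [(spike R k + 1) `^ (k.+1 * gamma)]
    is at least [(spike R k + 1) `^ (gamma + 2)], so that the quotient is at
    most [(spike R k + 1)^-1 <= k.+1%:R^-1]. *)
Lemma spike_decay (R : realType) (gamma : R) : 0 < gamma ->
  (spike R k + 1) `^ gamma * (spike R k + 1) / spike R k.+1 `^ gamma
    @[k --> \oo] --> 0.
Proof.
move=> g0; apply: (@squeeze_cvgr _ _ _ _ (cst 0) (@harmonic R)).
- near=> k.
  have s1 : 1 <= spike R k + 1 by rewrite lerDr ltW// spike_gt0.
  have s0 : 0 < spike R k + 1 by exact: lt_le_trans s1.
  apply/andP; split; first by rewrite divr_ge0 ?mulr_ge0 ?powR_ge0// ltW.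
  have kg : 2 <= k%:R * gamma.
    by rewrite -ler_pdivrMr//; near: k; exact: nbhs_infty_ger.
  rewrite /harmonic /= ler_pdivrMr ?powR_gt0 ?exprn_gt0//.
  rewrite -powR_mulrn ?(ltW s0)// -powRrM.
  rewrite [leRHS]mulrC ler_pdivlMr//.
  apply: (@le_trans _ _ ((spike R k + 1) `^ (gamma + 2))); last first.
    by rewrite ler_powR// -[k.+1%:R]natr1 mulrDl mul1r addrC lerD2r.
  rewrite powRD; last by rewrite (gt_eqF s0) implybT.
  rewrite (powR_mulrn 2) ?(ltW s0)// expr2 -mulrA.
  rewrite ler_wpM2l ?powR_ge0// ler_wpM2l ?(ltW s0)//.
  by apply: (le_trans (spike_ge R k)); rewrite lerDl.
- exact: cvg_cst.
- exact: cvg_harmonic.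
Unshelve. all: by end_near. Qed.

(** * The weight *)

Definition spikes (R : realType) (n : nat) : set 'rV[R]_n.+1 :=
  \bigcup_k brick R n (spike R k) (spike R k + 1).

(** On the brick at [spike R k], of volume one, the weight is about
    [spike R k `^ gamma]. This closed formula avoids a series of indicator
    functions and makes measurability immediate. *)
Definition weight (R : realType) (n : nat) (gamma : R) (x : 'rV[R]_n.+1) : R :=
  x ord0 ord0 `^ gamma * \1_(spikes R n) x.

Lemma weight_ge0 (R : realType) (n : nat) (gamma : R) x :
  0 <= weight R n gamma x.
Proof. by rewrite mulr_ge0 ?powR_ge0// indicE. Qed.

Lemma measurable_weight (R : realType) (n : nat) (gamma : R) :
  measurable_fun setT (weight R n gamma).
Proof.
apply: measurable_funM.
  exact: (measurableT_comp (@measurable_powR R gamma)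
           (@measurable_rV_coord R n.+1 ord0)).
apply: measurable_indic; apply: bigcupT_measurable => k.
exact: brick_measurable.
Qed.

(** On [D] the weight is dominated by the constant [M `^ gamma] on the brick
    with first side from [0] to [M], which contains every part of the support
    that [D] meets. *)
Lemma weight_integral_le (R : realType) (n : nat) (gamma M : R)
    (D : set 'rV[R]_n.+1) :
  0 <= gamma -> 0 <= M ->
  (forall x, D x -> spikes R n x -> x ord0 ord0 <= M) ->
  (\int[lebesgue_rV R n.+1]_(x in D) (weight R n gamma x)%:E
     <= (M `^ gamma * M)%:E)%E.
Proof.
move=> g0 M0 DM.
have -> : (M `^ gamma * M)%:E =
    (\int[lebesgue_rV R n.+1]_(x in brick R n 0 M) (M `^ gamma)%:E)%E.
  by rewrite integral_brick// subr0.
apply: le_integral_restrict => [x _|x _|x].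
- by rewrite lee_fin weight_ge0.
- by rewrite lee_fin powR_ge0.
rewrite !patchE; case: ifPn => [/set_mem Dx|_]; last first.
  by case: ifP => // _; rewrite lee_fin powR_ge0.
have [Sx|nSx] := pselect (spikes R n x); last first.
  rewrite /weight indicE memNset// mulr0.
  by case: ifP => // _; rewrite lee_fin powR_ge0.
have xM := DM _ Dx Sx; case: (Sx) => k _ bx.
have : spike R k < x ord0 ord0 <= spike R k + 1.
  exact: brick_coord0 bx.
move=> /andP[kx _]; have x0 := lt_trans (spike_gt0 R k) kx.
rewrite mem_set => [|i]; last first.
  have := bx i; rewrite /brick_side; case: ifP => [/eqP -> _|//].
  by rewrite /= in_itv/= x0.
rewrite /weight indicE mem_set// mulr1 lee_fin.
by rewrite ge0_ler_powR// nnegrE ltW.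
Qed.

Lemma weight_integral_ge (R : realType) (n : nat) (gamma : R) k
    (D : set 'rV[R]_n.+1) :
  0 <= gamma -> brick R n (spike R k) (spike R k + 1) `<=` D ->
  ((spike R k `^ gamma)%:E <=
     \int[lebesgue_rV R n.+1]_(x in D) (weight R n gamma x)%:E)%E.
Proof.
move=> g0 bD; set B := brick _ _ _ _ in bD.
have -> : (spike R k `^ gamma)%:E =
    (\int[lebesgue_rV R n.+1]_(x in B) (spike R k `^ gamma)%:E)%E.
  by rewrite integral_brick ?lerDl// [spike R k + 1]addrC addrK mulr1.
apply: le_integral_restrict => [x _|x _|x].
- by rewrite lee_fin powR_ge0.
- by rewrite lee_fin weight_ge0.
rewrite !patchE; case: ifPn => [/set_mem Bx|_]; last first.
  by case: ifP => // _; rewrite lee_fin weight_ge0.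
rewrite mem_set; last exact: bD.
have : spike R k < x ord0 ord0 <= spike R k + 1.
  exact: brick_coord0 Bx.
move=> /andP[kx _]; have x0 := lt_trans (spike_gt0 R k) kx.
rewrite /weight indicE mem_set; last by exists k.
by rewrite mulr1 lee_fin ge0_ler_powR ?nnegrE ?(ltW kx)// ltW// spike_gt0.
Qed.

(** * The mass of balls *)

Lemma ler_coord_enorm (R : realType) (n : nat) (x : 'rV[R]_n) i :
  x ord0 i <= enorm x.
Proof.
apply: (le_trans (ler_norm _)); rewrite -sqrtr_sqr ler_wsqrtr//.
by rewrite (bigD1 i)//= lerDl sumr_ge0// => j _; exact: sqr_ge0.
Qed.

(** The constant [n] instead of the optimal [Num.sqrt n] is good enough: any
    fixed multiple of [spike R k] will do as radius. *)
Lemma enorm_le_max (R : realType) (n : nat) (b : R) (x : 'rV[R]_n) :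
  0 <= b -> (forall i, `|x ord0 i| <= b) -> enorm x <= n%:R * b.
Proof.
move=> b0 xb; have nb0 : 0 <= n%:R * b by rewrite mulr_ge0.
rewrite -[leRHS]ger0_norm// -sqrtr_sqr ler_wsqrtr//.
apply: (@le_trans _ _ (\sum_(i < n) b ^+ 2)).
  apply: ler_sum => i _; rewrite -real_normK ?num_real//.
  by rewrite ler_sqr ?nnegrE.
rewrite sumr_const card_ord -[leLHS]mulr_natl exprMn ler_wpM2r ?sqr_ge0//.
by rewrite -natrX ler_nat; case: n {x xb nb0} => // n; rewrite leq_pmulr.
Qed.

Lemma brick_sub_ball (R : realType) (n : nat) k :
  brick R n (spike R k) (spike R k + 1) `<=`
  [set x | enorm x <= n.+1%:R * 2 * spike R k].
Proof.
move=> x bx; have s1 := spike_ge1 R k.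
rewrite /= -mulrA; apply: enorm_le_max => [|i]; first by lra.
have := bx i; rewrite /brick_side; case: ifP => _; rewrite /= in_itv/= => /andP[? ?].
  by rewrite ger0_norm; lra.
by rewrite ger0_norm; lra.
Qed.

(** A compact set is bounded in the maximum norm, hence in its first
    coordinate. *)
Lemma weight_locally_integrable (R : realType) (n : nat) (gamma : R) :
  0 <= gamma -> locally_integrable_rV (weight R n gamma).
Proof.
move=> g0; split; first exact: measurable_weight.
move=> K /compact_bounded [M [_ KM]].
have KM' x : K x -> x ord0 ord0 <= `|M| + 1.
  move=> Kx; apply: le_trans (ler_norm _) _.
  have /KM/(_ _ Kx)/= : M < `|M| + 1.
    by rewrite (le_lt_trans (ler_norm _))// ltrDl.
  apply: le_trans.
  rewrite /Num.norm/= mx_normrE.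
  exact: (le_bigmax _ _ (ord0, ord0)).
under eq_integral do rewrite ger0_norm ?weight_ge0//.
apply: (le_lt_trans (weight_integral_le R n gamma (`|M| + 1) K g0 _ _)).
- by rewrite addr_ge0.
- by move=> x Kx _; exact: KM'.
- exact: ltry.
Qed.

Lemma ball_mass_weightE (R : realType) (n : nat) (gamma r : R) : 0 <= gamma ->
  (ball_mass (weight R n gamma) r)%:E =
  (\int[lebesgue_rV R n.+1]_(x in [set x | (enorm x <= r)%R])
     (weight R n gamma x)%:E)%E.
Proof.
move=> g0; rewrite /ball_mass /Rintegral fineK// ge0_fin_numE; last first.
  by apply: integral_ge0 => x _; rewrite lee_fin weight_ge0.
apply: (le_lt_trans (weight_integral_le R n gamma `|r| _ g0 _ _)).
- exact: normr_ge0.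
- move=> x xr _; apply: le_trans (ler_norm r).
  exact: le_trans (ler_coord_enorm _ _ _ _) xr.
- exact: ltry.
Qed.

Lemma ball_mass_weight_ge0 (R : realType) (n : nat) (gamma r : R) :
  0 <= ball_mass (weight R n gamma) r.
Proof. by apply: Rintegral_ge0 => x _; exact: weight_ge0. Qed.

(** A point of the support in the ball of radius [spike R k.+1] belongs to a
    brick starting strictly before [spike R k.+1], that is, at [spike R j] with
    [j <= k]. *)
Lemma ball_mass_spike_le (R : realType) (n : nat) (gamma : R) k : 0 <= gamma ->
  ball_mass (weight R n gamma) (spike R k.+1) <=
  (spike R k + 1) `^ gamma * (spike R k + 1).
Proof.
move=> g0; rewrite -lee_fin ball_mass_weightE//.
apply: weight_integral_le => // [|x xr [j _ /brick_coord0/andP[jx xj]]].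
  by rewrite addr_ge0// ltW// spike_gt0.
apply: (le_trans xj); rewrite lerD2r; apply: spike_le.
rewrite leqNgt; apply/negP => /(spike_le R) kj.
have := le_lt_trans kj jx; rewrite ltNge => /negP; apply.
exact: le_trans (ler_coord_enorm _ _ _ _) xr.
Qed.

Lemma ball_mass_spike_ge (R : realType) (n : nat) (gamma : R) k : 0 <= gamma ->
  spike R k `^ gamma <=
  ball_mass (weight R n gamma) (n.+1%:R * 2 * spike R k).
Proof.
move=> g0; rewrite -lee_fin ball_mass_weightE//.
by apply: weight_integral_ge => //; exact: brick_sub_ball.
Qed.

Theorem proposition4p1 (R : realType) (N : nat) (gamma : R) :
  (1 <= N)%N -> 0 < gamma < N%:R ->
  exists w : 'rV[R]_N -> R,
    [/\ forall x, 0 <= w x,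
        locally_integrable_rV w &
        let F := ball_mass w in
        [/\ (0 < limf_esup (fun r : R => (F r / r `^ gamma)%:E) +oo%R)%E,
            limf_einf (fun r : R => (F r / r `^ gamma)%:E) +oo%R = 0%E,
            ~ regularly_varying gamma F,
            ~ (0 < limf_einf (fun r : R => (r `^ (- gamma) * F r)%:E) +oo%R)%E &
            ~ ((\forall r \near +oo%R, 0 < F r) /\ regularly_varying gamma F)]].
Proof.
case: N => [//|n] _ /andP[g0 _].
exists (weight R n gamma); split=> [x||F].
- exact: weight_ge0.
- exact/weight_locally_integrable/ltW.
have F0 r : 0 <= F r / r `^ gamma.
  by rewrite divr_ge0 ?powR_ge0// ball_mass_weight_ge0.
pose l : R := n.+1%:R * 2.
have l0 : 0 < l by rewrite mulr_gt0.
have Fl k : spike R k `^ gamma <= F (l * spike R k).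
  exact/ball_mass_spike_ge/ltW.
have aoo : spike R k.+1 @[k --> \oo] --> +oo.
  by rewrite (cvg_shiftS (spike R)); exact: spike_cvg.
have Fa0 : F (spike R k.+1) / spike R k.+1 `^ gamma @[k --> \oo] --> 0.
  apply: squeeze_cvgr (cvg_cst 0) (spike_decay R gamma g0).
  apply: nearW => k; rewrite F0 andTb ler_pM2r ?invr_gt0 ?powR_gt0 ?spike_gt0//.
  exact/ball_mass_spike_le/ltW.
have inf0 : limf_einf (fun r : R => (F r / r `^ gamma)%:E) +oo%R = 0%E.
  exact: limf_einf_seq0 F0 aoo Fa0.
have nRV : ~ regularly_varying gamma F.
  apply: (not_regularly_varying_seq _ _ _ 1 _ _ l0 ltr01 aoo Fa0) => k.
  by rewrite ler_pdivlMr ?powR_gt0 ?spike_gt0// mul1r.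
split=> //; last by case.
- have loo : l * spike R k.+1 @[k --> \oo] --> +oo.
    apply/cvgryPge => A; move/cvgryPge: aoo => /(_ (l^-1 * A)).
    by apply: filterS => k; rewrite ler_pdivrMl.
  have lg0 : (0 < (l `^ gamma)^-1%:E)%E by rewrite lte_fin invr_gt0 powR_gt0.
  apply: (lt_le_trans lg0); apply: (le_limf_esup_seq _ _ _ _ loo) => k.
  rewrite lee_fin powRM ?(ltW l0) ?(ltW (spike_gt0 _ _))//.
  rewrite invfM mulrCA ler_peMr ?invr_ge0 ?powR_ge0//.
  by rewrite ler_pdivlMr ?powR_gt0 ?spike_gt0// mul1r.
- under eq_fun do rewrite powRN mulrC.
  by rewrite inf0 ltxx.
Qed.
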